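(* Let $As_3^3$ be the three-dimensional complex associative algebra with basis $\{e_1,e_2,e_3\}$ and only non-zero product $e_1e_1=e_3$. Any three-dimensional complex anti-dendriform algebra associated to $As_3^3$ is isomorphic to one of the following pairwise non-isomorphic algebras (with basis $\{e_1,e_2,e_3\}$, omitted products being zero, and $\alpha,\beta\in\mathbb{C}$): $AD_3^{18}(\alpha):\ e_1\vartriangleright e_1=\alpha e_3,\ e_1\vartriangleleft e_1=(1-\alpha)e_3;$ $AD_3^{19}:\ e_2\vartriangleright e_1=e_3,\ e_1\vartriangleleft e_1=e_3,\ e_2\vartriangleleft e_1=-e_3;$ $AD_3^{20}(\alpha):\ e_1\vartriangleright e_1=\alpha e_3,\ e_1\vartriangleright e_2=e_3,\ e_2\vartriangleright e_1=-e_3,\ e_1\vartriangleleft e_1=(1-\alpha)e_3,\ e_1\vartriangleleft e_2=-e_3,\ e_2\vartriangleleft e_1=e_3;$ $AD_3^{21}(\alpha)$, $\alpha\neq -1$: $\ e_1\vartriangleright e_2=e_3,\ e_2\vartriangleright e_1=\alpha e_3,\ e_1\vartriangleleft e_1=e_3,\ e_1\vartriangleleft e_2=-e_3,\ e_2\vartriangleleft e_1=-\alpha e_3;$ $AD_3^{22}(\alpha,\beta):\ e_1\vartriangleright e_1=\alpha e_3,\ e_2\vartriangleright e_1=\beta e_3,\ e_2\vartriangleright e_2=e_3,\ e_1\vartriangleleft e_1=(1-\alpha)e_3,\ e_2\vartriangleleft e_1=-\beta e_3,\ e_2\vartriangleleft e_2=-e_3;$ $AD_3^{23}:\ e_1\vartriangleright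 e_1=e_2,\ e_1\vartriangleleft e_1=-e_2+e_3;$ where $AD_3^{21}(-1)\cong AD_3^{20}(0)$ (here $AD_3^{21}(-1)$ denotes the algebra given by the formulas for $AD_3^{21}(\alpha)$ with the excluded value $\alpha=-1$).
   Context: An anti-dendriform algebra is a vector space $A$ with two bilinear operations $\vartriangleright,\vartriangleleft: A\otimes A\to A$ such that, writing $x\cdot y=x\vartriangleright y+x\vartriangleleft y$, for all $x,y,z\in A$: $x\vartriangleright(y\vartriangleright z)=-(x\cdot y)\vartriangleright z=-x\vartriangleleft(y\cdot z)=(x\vartriangleleft y)\vartriangleleft z$ and $(x\vartriangleright y)\vartriangleleft z=x\vartriangleright(y\vartriangleleft z)$. Then $(A,\cdot)$ is an associative algebra, called the associated associative algebra of $(A,\vartriangleright,\vartriangleleft)$. An anti-dendriform algebra is associated to an associative algebra $B$ if its associated associative algebra is (isomorphic to) $B$. Isomorphisms of anti-dendriform algebras are linear bijections preserving both operations $\vartriangleright$ and $\vartriangleleft$.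
   Formalization: The listed algebras are not pairwise non-isomorphic as claimed: e_2 -> -e_2 gives AD_3^{22}(α,β) ≅ AD_3^{22}(α,-β). The formal theorem states that two listed algebras are isomorphic exactly when they are equal or form such a pair. *)

(* Defs.v *)
From mathcomp Require Import all_boot all_algebra.
From mathcomp Require Import reals complex.

Set Implicit Arguments.
Unset Strict Implicit.
Unset Printing Implicit Defensive.

Import GRing.Theory.
Local Open Scope ring_scope.

Section AntiDendriform.

Variable K : fieldType.

Definition bilinear_op (A : vectType K) (m : A -> A -> A) : Prop :=
  bilinear_for *:%R *:%R m.

(* The product of the associated associative algebra of (A, r, l). *)
Definition assoc_prod (A : vectType K) (r l : A -> A -> A) (x y : A) : A :=
  r x y + l x y.

(* [r] and [l] are the right- and left-pointing triangle operations. *)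
Record anti_dendriform (A : vectType K) (r l : A -> A -> A) : Prop :=
  AntiDendriform {
    ad_bilinear_r : bilinear_op r;
    ad_bilinear_l : bilinear_op l;
    ad_rr_dotr : forall x y z, r x (r y z) = - r (assoc_prod r l x y) z;
    ad_dotr_ldot : forall x y z,
      - r (assoc_prod r l x y) z = - l x (assoc_prod r l y z);
    ad_ldot_ll : forall x y z, - l x (assoc_prod r l y z) = l (l x y) z;
    ad_rl : forall x y z, l (r x y) z = r x (l y z)
  }.

Definition alg_iso (A B : vectType K) (mA : A -> A -> A) (mB : B -> B -> B)
    : Prop :=
  exists f : {linear A -> B},
    bijective f /\ forall x y, f (mA x y) = mB (f x) (f y).

Definition ad_iso (A B : vectType K) (rA lA : A -> A -> A)
    (rB lB : B -> B -> B) : Prop :=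
  exists f : {linear A -> B},
    [/\ bijective f,
        forall x y, f (rA x y) = rB (f x) (f y)
      & forall x y, f (lA x y) = lB (f x) (f y)].

Definition associated_to (A B : vectType K) (r l : A -> A -> A)
    (mB : B -> B -> B) : Prop :=
  alg_iso (assoc_prod r l) mB.

Definition i1 : 'I_3 := @Ordinal 3 0 isT.
Definition i2 : 'I_3 := @Ordinal 3 1 isT.
Definition i3 : 'I_3 := @Ordinal 3 2 isT.

Definition e2 : 'rV[K]_3 := delta_mx 0 i2.
Definition e3 : 'rV[K]_3 := delta_mx 0 i3.

(* Bilinear product on K^3 with e_i * e_j = v for each entry ((i, j), v) of
   the table [t], all other products of basis vectors being zero; no pair
   (i, j) is to occur twice in [t]. *)
Definition table_prod (t : seq ('I_3 * 'I_3 * 'rV[K]_3)) (x y : 'rV[K]_3)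
    : 'rV[K]_3 :=
  \sum_(p <- t) (x 0 p.1.1 * y 0 p.1.2) *: p.2.

Definition As33 : 'rV[K]_3 -> 'rV[K]_3 -> 'rV[K]_3 :=
  table_prod [:: (i1, i1, e3)].

Inductive ad_label : Type :=
  | AD18 of K
  | AD19
  | AD20 of K
  | AD21 of K
  | AD22 of K & K
  | AD23.

(* AD21 (-1) is a label, but it is not a member of the list. *)
Definition listed (s : ad_label) : Prop :=
  if s is AD21 a then a <> -1 else True.

Definition ad_r (s : ad_label) : 'rV[K]_3 -> 'rV[K]_3 -> 'rV[K]_3 :=
  match s with
  | AD18 a => table_prod [:: (i1, i1, a *: e3)]
  | AD19 => table_prod [:: (i2, i1, e3)]
  | AD20 a => table_prod [:: (i1, i1, a *: e3); (i1, i2, e3); (i2, i1, - e3)]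
  | AD21 a => table_prod [:: (i1, i2, e3); (i2, i1, a *: e3)]
  | AD22 a b =>
      table_prod [:: (i1, i1, a *: e3); (i2, i1, b *: e3); (i2, i2, e3)]
  | AD23 => table_prod [:: (i1, i1, e2)]
  end.

Definition ad_l (s : ad_label) : 'rV[K]_3 -> 'rV[K]_3 -> 'rV[K]_3 :=
  match s with
  | AD18 a => table_prod [:: (i1, i1, (1 - a) *: e3)]
  | AD19 => table_prod [:: (i1, i1, e3); (i2, i1, - e3)]
  | AD20 a =>
      table_prod [:: (i1, i1, (1 - a) *: e3); (i1, i2, - e3); (i2, i1, e3)]
  | AD21 a =>
      table_prod [:: (i1, i1, e3); (i1, i2, - e3); (i2, i1, - a *: e3)]
  | AD22 a b =>
      table_prod
        [:: (i1, i1, (1 - a) *: e3); (i2, i1, - b *: e3); (i2, i2, - e3)]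
  | AD23 => table_prod [:: (i1, i1, - e2 + e3)]
  end.

End AntiDendriform.

Arguments ad_label K : clear implicits.
Arguments AD19 {K}.
Arguments AD23 {K}.

(* Main.v *)
Require Import Defs.
From HB Require Import structures.
From mathcomp Require Import all_boot all_algebra.
From mathcomp Require Import reals complex ring.

(** Transporting the structure along the given isomorphism of associative
algebras, one may assume that it lives on K^3 with x . y = x_1 y_1 e_3.  Then
the left operation is determined by the right one, r, and the question is
which bilinear r give an anti-dendriform algebra.

Because the product takes its values in the line of e_3, the identity
(x . y) r z = x l (y . z) forces e_3 r z and x l e_3 to be multiples of a
single vector w.  A short computation, where dimension three is essential,
shows w = 0 ([e3_annihilates]).  So e_3 annihilates everything, and the axioms
collapse to: r takes its values in the span of e_2 and e_3, and any product of
three vectors formed with r vanishes ([nil_split_of_anti_dendriform], with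
converse [anti_dendriform_of_nil_split]).  There are two possibilities
([nil_splitP]).
- Some value of r has a nonzero e_2-component.  Then e_2 annihilates as well,
  only e_1 r e_1 survives, and a change of basis makes it e_2; this is AD23.
- All values of r are multiples of e_3.  Then r is a bilinear form on the span
  of e_1 and e_2, given by its 2 x 2 Gram matrix.

In the second case, rescaling an automorphism of As33 so that it fixes the
e_1-component, isomorphism becomes the congruence of Gram matrices under the
substitutions e_1 -> e_1 + b e_2, e_2 -> c e_2 with c nonzero
([ad_iso_of_congruent], [congruent_of_ad_iso]).  The remaining labels are the
normal forms for this action ([congruent_listed]); reaching them takes a
square root of the entry g22, and everything else works over any field.  The
normal forms are told apart by the vanishing of g22 and, when g22 = 0, by the
vanishing of g12 and of g21, the ratio of these two entries, and g11 when
g12 + g21 = 0; when g22 = 1 and g12 = 0, only the sign of g21 can still change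
([congruent_separates]). *)

Set Implicit Arguments.
Unset Strict Implicit.
Unset Printing Implicit Defensive.

Import GRing.Theory.
Local Open Scope ring_scope.

(** * Coordinates on K^3 and bilinear operations *)

Lemma row3P (K : fieldType) (x y : 'rV[K]_3) :
  x 0 i1 = y 0 i1 -> x 0 i2 = y 0 i2 -> x 0 i3 = y 0 i3 -> x = y.
Proof.
move=> h1 h2 h3; apply/rowP => -[[|[|[|//]]] hj].
- by rewrite (_ : Ordinal hj = i1) //; apply/val_inj.
- by rewrite (_ : Ordinal hj = i2) //; apply/val_inj.
- by rewrite (_ : Ordinal hj = i3) //; apply/val_inj.
Qed.

Definition e1 (K : fieldType) : 'rV[K]_3 := delta_mx 0 i1.

Lemma basis_coordE (K : fieldType) :
  ((e1 K 0 i1 = 1) * (e1 K 0 i2 = 0) * (e1 K 0 i3 = 0)) *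
  ((e2 K 0 i1 = 0) * (e2 K 0 i2 = 1) * (e2 K 0 i3 = 0)) *
  ((e3 K 0 i1 = 0) * (e3 K 0 i2 = 0) * (e3 K 0 i3 = 1)).
Proof. by rewrite !mxE. Qed.

Definition coordE := (basis_coordE, mxE).

Lemma row3_decomp (K : fieldType) (x : 'rV[K]_3) :
  x = x 0 i1 *: e1 K + x 0 i2 *: e2 K + x 0 i3 *: e3 K.
Proof. by apply: row3P; rewrite !mxE /=; ring. Qed.

Lemma e3_neq0 (K : fieldType) : e3 K != 0.
Proof.
apply/eqP => /(congr1 (fun v : 'rV[K]_3 => v 0 i3)) /eqP.
by rewrite !coordE oner_eq0.
Qed.

Lemma As33E (K : fieldType) (x y : 'rV[K]_3) :
  As33 x y = (x 0 i1 * y 0 i1) *: e3 K.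
Proof. by rewrite /As33 /table_prod big_seq1. Qed.

Lemma bilinear_opE (K : fieldType) (A : vectType K) (m : A -> A -> A) :
  bilinear_op m ->
  [/\ forall x y z, m (x + y) z = m x z + m y z,
      forall x y z, m x (y + z) = m x y + m x z,
      forall a x y, m (a *: x) y = a *: m x y
    & forall a x y, m x (a *: y) = a *: m x y].
Proof.
move=> [hl hr].
have D x y z : m (x + y) z = m x z + m y z.
  by have := hl z 1 x y; rewrite /= !scale1r.
have D' x y z : m x (y + z) = m x y + m x z.
  by have := hr x 1 y z; rewrite /= !scale1r.
have m0 y : m 0 y = 0 by apply: (@addrI _ (m 0 y)); rewrite -D !addr0.
have m0' x : m x 0 = 0 by apply: (@addrI _ (m x 0)); rewrite -D' !addr0.
split=> // a x y.
- by have := hl y a x 0; rewrite /= !addr0 m0 addr0.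
- by have := hr x a y 0; rewrite /= !addr0 m0' addr0.
Qed.

(** * Isomorphisms and transport of structure *)

Lemma alg_iso_refl (K : fieldType) (A : vectType K) (m m' : A -> A -> A) :
  m =2 m' -> alg_iso m m'.
Proof.
move=> mm'; exists (idfun : {linear A -> A}).
by split=> [|x y /=]; [exact: (inv_bij (f := idfun)) | rewrite mm'].
Qed.

Lemma ad_iso_refl (K : fieldType) (A : vectType K) (r l r' l' : A -> A -> A) :
  r =2 r' -> l =2 l' -> ad_iso r l r' l'.
Proof.
move=> rr' ll'; exists (idfun : {linear A -> A}).
by split=> [|x y /=|x y /=]; [exact: (inv_bij (f := idfun)) | rewrite rr'
  | rewrite ll'].
Qed.

Lemma bij_linear_inverse (K : fieldType) (A B : vectType K)
    (f : {linear A -> B}) :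
  bijective f -> exists g : {linear B -> A}, cancel f g /\ cancel g f.
Proof.
case=> g fK gK; have g_lin := can2_linear fK gK.
pose gL := GRing.isLinear.Build K B A *:%R g g_lin.
by exists (HB.pack_for {linear B -> A} g gL).
Qed.

Lemma ad_iso_sym (K : fieldType) (A B : vectType K) (r l : A -> A -> A)
    (r' l' : B -> B -> B) : ad_iso r l r' l' -> ad_iso r' l' r l.
Proof.
case=> f [fB fr fl]; have [g [fK gK]] := bij_linear_inverse fB.
exists g; split=> [|x y|x y]; first by exists f.
- by apply: (can_inj fK); rewrite fr !gK.
- by apply: (can_inj fK); rewrite fl !gK.
Qed.

Lemma ad_iso_trans (K : fieldType) (A B C : vectType K) (rA lA : A -> A -> A)
    (rB lB : B -> B -> B) (rC lC : C -> C -> C) :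
  ad_iso rA lA rB lB -> ad_iso rB lB rC lC -> ad_iso rA lA rC lC.
Proof.
case=> f [fB fr fl] [g [gB gr gl]]; exists (g \o f : {linear A -> C}).
by split=> [|x y|x y] /=; [exact: bij_comp | rewrite fr gr | rewrite fl gl].
Qed.

(** The normalisation under which everything below takes place: the associated
product is not merely isomorphic but equal to the one of As33, so that r alone
determines l. *)
Definition splits_As33 (K : fieldType)
    (r l : 'rV[K]_3 -> 'rV[K]_3 -> 'rV[K]_3) :=
  forall x y, assoc_prod r l x y = As33 x y.

Lemma transport_to_As33 (K : fieldType) (A : vectType K) (r l : A -> A -> A) :
  anti_dendriform r l -> associated_to r l (@As33 K) ->
  exists r' l' : 'rV[K]_3 -> 'rV[K]_3 -> 'rV[K]_3,
    [/\ anti_dendriform r' l', splits_As33 r' l' & ad_iso r l r' l'].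
Proof.
move=> [[rl1 rl2] [ll1 ll2] h1 h2 h3 h4] [f [fB fM]].
have [g [fK gK]] := bij_linear_inverse fB.
pose r' x y := f (r (g x) (g y)); pose l' x y := f (l (g x) (g y)).
have dotE x y : assoc_prod r' l' x y = f (assoc_prod r l (g x) (g y)).
  by rewrite /assoc_prod /r' /l' raddfD.
exists r', l'; split.
- split.
  + split=> u a x y; rewrite /r' /= linearP.
      by have /= -> := rl1 (g u) a (g x) (g y); rewrite linearP.
    by have /= -> := rl2 (g u) a (g x) (g y); rewrite linearP.
  + split=> u a x y; rewrite /l' /= linearP.
      by have /= -> := ll1 (g u) a (g x) (g y); rewrite linearP.
    by have /= -> := ll2 (g u) a (g x) (g y); rewrite linearP.
  + by move=> x y z; rewrite dotE /r' !fK -raddfN h1.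
  + by move=> x y z; rewrite !dotE /r' /l' !fK -!raddfN h2.
  + by move=> x y z; rewrite !dotE /l' !fK -!raddfN h3.
  + by move=> x y z; rewrite /r' /l' !fK h4.
- by move=> x y; rewrite dotE fM !gK.
- by exists f; split=> // x y; rewrite /r' /l' !fK.
Qed.

(** * Anti-dendriform structures on As33 as two-step nilpotent products *)

(** What the axioms amount to for the right operation of a splitting of
As33. *)
Record nil_split (K : fieldType) (r : 'rV[K]_3 -> 'rV[K]_3 -> 'rV[K]_3) :
    Prop := NilSplit {
  ns_bilinear : bilinear_op r;
  ns_e3l : forall z, r (e3 K) z = 0;
  ns_e3r : forall x, r x (e3 K) = 0;
  ns_rr : forall x y z, r x (r y z) = 0;
  ns_rl : forall x y z, r (r x y) z = 0;
  ns_coord1 : forall x y, r x y 0 i1 = 0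
}.

Lemma splits_As33_l (K : fieldType) (r l : 'rV[K]_3 -> 'rV[K]_3 -> 'rV[K]_3) :
  splits_As33 r l ->
  forall x y, l x y = (x 0 i1 * y 0 i1) *: e3 K - r x y.
Proof.
by move=> h x y; rewrite -As33E -h /assoc_prod addrAC subrr add0r.
Qed.

Lemma anti_dendriform_of_nil_split (K : fieldType)
    (r l : 'rV[K]_3 -> 'rV[K]_3 -> 'rV[K]_3) :
  splits_As33 r l -> nil_split r -> anti_dendriform r l.
Proof.
move=> hS [rB e3l e3r rr rl r1]; have lE := splits_As33_l hS.
have [Dl Dr Zl Zr] := bilinear_opE rB.
have Nl x y : r (- x) y = - r x y by rewrite -scaleN1r Zl scaleN1r.
have Nr x y : r x (- y) = - r x y by rewrite -scaleN1r Zr scaleN1r.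
split=> // [|x y z|x y z|x y z|x y z].
- split=> u a x y; rewrite /= !lE ?(Dl, Dr, Zl, Zr).
    by apply: row3P; rewrite !mxE; ring.
  by apply: row3P; rewrite !mxE; ring.
- by rewrite rr hS As33E Zl e3l scaler0 oppr0.
- rewrite !hS !As33E Zl e3l lE Zr e3r.
  by apply: row3P; rewrite !coordE; ring.
- rewrite hS As33E !lE Dl Zl Nl Zr e3l e3r rl !coordE r1.
  by apply: row3P; rewrite !mxE; ring.
- rewrite !lE Dr Zr Nr rl rr e3r r1.
  by apply: row3P; rewrite !mxE; ring.
Qed.

(** Evaluating (x . y) r z = x l (y . z) gives e_3 r z = z_1 w and
x l e_3 = x_1 w for w = e_3 r e_1, hence x r e_3 = - x_1 w and
x r (y r z) = - x_1 y_1 z_1 w.  If w were nonzero, then u = e_1 r e_1 and e_3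
would be independent vectors without e_1-component, on which multiplication by
e_1 is known on both sides: e_1 r u = e_1 r e_3 = - w, u r e_1 = 0,
e_3 r e_1 = w.  The vector w itself is a combination of u and e_3 killed by
e_1 on both sides, and these values make both coefficients vanish. *)
Lemma e3_annihilates (K : fieldType)
    (r l : 'rV[K]_3 -> 'rV[K]_3 -> 'rV[K]_3) :
  splits_As33 r l -> anti_dendriform r l ->
  (forall z, r (e3 K) z = 0) /\ (forall x, r x (e3 K) = 0).
Proof.
move=> hS [rB lB h1 h2 h3 h4]; have lE := splits_As33_l hS.
have [Dl Dr Zl Zr] := bilinear_opE rB.
have [_ _ _ ZrL] := bilinear_opE lB.
pose w := r (e3 K) (e1 K).
have mid (x y z : 'rV[K]_3) :
    (x 0 i1 * y 0 i1) *: r (e3 K) z = (y 0 i1 * z 0 i1) *: l x (e3 K).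
  have /oppr_inj := h2 x y z; by rewrite !hS !As33E Zl ZrL.
have le3 x : l x (e3 K) = x 0 i1 *: w.
  by have := mid x (e1 K) (e1 K); rewrite !coordE !mul1r mulr1 scale1r.
have e3r z : r (e3 K) z = z 0 i1 *: w.
  have := mid (e1 K) (e1 K) z.
  by rewrite !coordE !mul1r scale1r le3 coordE scale1r.
have re3 x : r x (e3 K) = - x 0 i1 *: w.
  have := le3 x; rewrite lE coordE mulr0 scale0r sub0r => /eqP.
  by rewrite eqr_oppLR -scaleNr => /eqP.
suff w0 : w = 0 by split=> z; rewrite (e3r, re3) w0 scaler0.
have rr x y z : r x (r y z) = - (x 0 i1 * y 0 i1 * z 0 i1) *: w.
  by rewrite h1 hS As33E Zl e3r scalerA scaleNr.
apply/eqP/negPn/negP => wN0.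
have scw0 a : a *: w = 0 -> a = 0.
  by move=> /eqP; rewrite scaler_eq0 (negPf wN0) orbF => /eqP.
(* Multiplying products by e3 on the left shows that no product has an
   e1-component. *)
have r1 x y : r x y 0 i1 = 0.
  apply: scw0; rewrite -e3r rr; rewrite coordE !mul0r oppr0 scale0r //.
pose u := r (e1 K) (e1 K).
have u1 : u 0 i1 = 0 by exact: r1.
have e1u : r (e1 K) u = - w by rewrite rr !coordE !mulr1 scaleN1r.
have ue1 : r u (e1 K) = 0.
  have := h4 (e1 K) (e1 K) (e1 K).
  rewrite -/u !lE u1 !coordE mul0r scale0r sub0r mulr1 scale1r.
  rewrite Dr -scaleN1r -[- u]scaleN1r Zr -/u e1u re3 coordE.
  by rewrite !scaleN1r opprK addNr => /eqP; rewrite oppr_eq0 => /eqP.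
have w1 : w 0 i1 = 0 by exact: r1.
have e1w : r (e1 K) w = 0.
  by rewrite /w rr !coordE !(mulr0, mul0r) oppr0 scale0r.
have we1 : r w (e1 K) = 0.
  have := h4 (e1 K) (e3 K) (e1 K).
  rewrite [l (e3 K) _]lE -/w !coordE mul0r scale0r sub0r -[- w]scaleN1r Zr e1w.
  rewrite scaler0 re3 coordE scaleN1r lE mxE w1 oppr0 mul0r scale0r sub0r.
  by rewrite -[- w]scaleN1r Zl scaleN1r opprK.
have vE (v : 'rV[K]_3) : v 0 i1 = 0 -> v = v 0 i2 *: e2 K + v 0 i3 *: e3 K.
  by move=> v1; rewrite {1}[v]row3_decomp v1 scale0r add0r.
pose b := u 0 i2; pose c := u 0 i3.
have uE : u = b *: e2 K + c *: e3 K by exact: vE.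
have b0 : b != 0.
  apply/eqP => b0; move: uE; rewrite b0 scale0r add0r => uE.
  move: e1u ue1; rewrite uE Zr Zl re3 e3r !coordE scale1r scaleN1r.
  move=> h /scw0 c0; move: h; rewrite c0 scale0r => /eqP.
  by rewrite eq_sym oppr_eq0 (negPf wN0).
(* In dimension three u and e3 span the vectors without e1-component, so w is
   a combination of them, which multiplication by e1 on both sides kills. *)
have bw : b *: w = w 0 i2 *: u + (b * w 0 i3 - w 0 i2 * c) *: e3 K.
  by rewrite uE; apply: row3P; rewrite !coordE ?w1; ring.
move: (congr1 (r^~ (e1 K)) bw) => /=.
rewrite Zl we1 Dl !Zl ue1 e3r !coordE scale1r !scaler0 add0r => /esym/scw0 h.
move: (congr1 (r (e1 K)) bw); rewrite h scale0r addr0 !Zr e1w e1u scaler0.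
rewrite -scaleN1r scalerA => /esym/scw0/eqP; rewrite mulrN1 oppr_eq0 => /eqP w2.
move: h; rewrite w2 mul0r subr0 => /eqP; rewrite mulf_eq0 (negPf b0) /= => /eqP.
move=> w3; move: wN0; rewrite [w]vE // w2 w3 !scale0r addr0.
by rewrite eqxx.
Qed.

(** With e_3 an annihilator, (x r y) l z = x r (y l z) becomes
(x r y) r z = (x r y)_1 z_1 e_3.  For z = x r y the left-hand side is a
product of the form u r (x r y), which vanishes, so (x r y)_1 squares to
zero. *)
Lemma nil_split_of_anti_dendriform (K : fieldType)
    (r l : 'rV[K]_3 -> 'rV[K]_3 -> 'rV[K]_3) :
  splits_As33 r l -> anti_dendriform r l -> nil_split r.
Proof.
move=> hS hA; have [e3l e3r] := e3_annihilates hS hA.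
case: hA => rB lB h1 h2 h3 h4; have lE := splits_As33_l hS.
have [Dl Dr Zl Zr] := bilinear_opE rB.
have rr x y z : r x (r y z) = 0.
  by rewrite h1 hS As33E Zl e3l scaler0 oppr0.
have ru x y z : r (r x y) z = (r x y 0 i1 * z 0 i1) *: e3 K.
  have := h4 x y z; rewrite !lE Dr Zr e3r -[- r y z]scaleN1r Zr rr.
  by rewrite !scaler0 addr0 => /eqP; rewrite subr_eq0 => /eqP.
have r1 x y : r x y 0 i1 = 0.
  have := ru x y (r x y); rewrite rr => /esym/eqP.
  by rewrite scaler_eq0 (negPf (e3_neq0 K)) orbF mulf_eq0 orbb => /eqP.
by split=> // x y z; rewrite ru r1 mul0r scale0r.
Qed.

(** * The two families of solutions *)

Record gram (K : fieldType) := Gram { g11 : K; g12 : K; g21 : K; g22 : K }.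

Definition form_prod (K : fieldType) (g : gram K) (x y : 'rV[K]_3) :
    'rV[K]_3 :=
  (g11 g * x 0 i1 * y 0 i1 + g12 g * x 0 i1 * y 0 i2
   + g21 g * x 0 i2 * y 0 i1 + g22 g * x 0 i2 * y 0 i2) *: e3 K.

Definition square_prod (K : fieldType) (v x y : 'rV[K]_3) : 'rV[K]_3 :=
  (x 0 i1 * y 0 i1) *: v.

Lemma nil_split_form (K : fieldType) (g : gram K) : nil_split (form_prod g).
Proof.
rewrite /form_prod; split.
- by split=> u a x y /=; apply: row3P; rewrite !coordE; ring.
all: by move=> *; try apply: row3P; rewrite !coordE; ring.
Qed.

Lemma nil_split_square (K : fieldType) (v : 'rV[K]_3) :
  v 0 i1 = 0 -> nil_split (square_prod v).
Proof.
move=> v1; rewrite /square_prod; split.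
- by split=> u a x y /=; apply: row3P; rewrite !coordE; ring.
all: by move=> *; try apply: row3P; rewrite !coordE ?v1; ring.
Qed.

(** If u = p r q has a nonzero e_2-component, then e_2 is a combination of u
and e_3, both of which annihilate every vector; so r factors through the
e_1-components. *)
Lemma nil_splitP (K : fieldType) (r : 'rV[K]_3 -> 'rV[K]_3 -> 'rV[K]_3) :
  nil_split r ->
  (exists2 v : 'rV[K]_3, v 0 i1 = 0 /\ v 0 i2 != 0 & r =2 square_prod v) \/
  (exists g : gram K, r =2 form_prod g).
Proof.
case=> rB e3l e3r rr rl r1; have [Dl Dr Zl Zr] := bilinear_opE rB.
have rE x y : r x y = (x 0 i1 * y 0 i1) *: r (e1 K) (e1 K)
    + (x 0 i1 * y 0 i2) *: r (e1 K) (e2 K)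
    + (x 0 i2 * y 0 i1) *: r (e2 K) (e1 K)
    + (x 0 i2 * y 0 i2) *: r (e2 K) (e2 K).
  rewrite {1}[x]row3_decomp {1}[y]row3_decomp !(Dl, Dr, Zl, Zr, e3l, e3r).
  by apply: row3P; rewrite !mxE; ring.
have colin p q : r p q 0 i2 != 0 ->
    (forall z, r (e2 K) z = 0) /\ (forall x, r x (e2 K) = 0).
  set u := r p q => u2.
  have uE : e2 K = (u 0 i2)^-1 *: (u - u 0 i3 *: e3 K).
    by apply: row3P; rewrite !coordE ?r1; field.
  split=> z; rewrite uE -scaleN1r !(Zl, Zr, Dl, Dr).
    by rewrite rl e3l !scaler0 addr0 scaler0.
  by rewrite rr e3r !scaler0 addr0 scaler0.
case: (boolP [&& r (e1 K) (e1 K) 0 i2 == 0, r (e1 K) (e2 K) 0 i2 == 0,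
    r (e2 K) (e1 K) 0 i2 == 0 & r (e2 K) (e2 K) 0 i2 == 0]).
  move=> /and4P[/eqP z11 /eqP z12 /eqP z21 /eqP z22]; right.
  exists (Gram (r (e1 K) (e1 K) 0 i3) (r (e1 K) (e2 K) 0 i3)
    (r (e2 K) (e1 K) 0 i3) (r (e2 K) (e2 K) 0 i3)) => x y.
  rewrite /form_prod rE /=.
  by apply: row3P; rewrite !coordE ?r1 ?z11 ?z12 ?z21 ?z22; ring.
rewrite !negb_and => nz.
have [e2l e2r] : (forall z, r (e2 K) z = 0) /\ (forall x, r x (e2 K) = 0).
  by case/or4P: nz => /colin.
have [r2|r2] := eqVneq (r (e1 K) (e1 K) 0 i2) 0.
  right; exists (Gram (r (e1 K) (e1 K) 0 i3) 0 0 0) => x y.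
  rewrite /form_prod rE !e2l !e2r /=.
  by apply: row3P; rewrite !coordE ?r1 ?r2; ring.
left; exists (r (e1 K) (e1 K)) => // x y.
by rewrite rE !e2l !e2r !scaler0 !addr0.
Qed.

(** * Changes of basis and congruence of Gram matrices *)

(** The automorphism e_1 -> e_1 + b e_2, e_2 -> c e_2 + d e_3, e_3 -> e_3 of
As33 (for nonzero c).  Up to a scaling of e_1 and e_2 by a and of e_3 by
a ^+ 2, and up to the e_3-component of the image of e_1, these are all the
automorphisms. *)
Definition shear (K : fieldType) (b c d : K) (x : 'rV[K]_3) : 'rV[K]_3 :=
  x 0 i1 *: e1 K + (b * x 0 i1 + c * x 0 i2) *: e2 K
  + (d * x 0 i2 + x 0 i3) *: e3 K.

Lemma shear_is_linear (K : fieldType) (b c d : K) : linear (shear b c d).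
Proof. by move=> a x y; apply: row3P; rewrite !coordE; ring. Qed.

HB.instance Definition _ (K : fieldType) (b c d : K) :=
  GRing.isLinear.Build K 'rV[K]_3 'rV[K]_3 *:%R (shear b c d)
    (shear_is_linear b c d).

Lemma shear_coord (K : fieldType) (b c d : K) (x : 'rV[K]_3) :
  (shear b c d x 0 i1 = x 0 i1) *
  (shear b c d x 0 i2 = b * x 0 i1 + c * x 0 i2) *
  (shear b c d x 0 i3 = d * x 0 i2 + x 0 i3).
Proof. by rewrite !coordE; do !split; ring. Qed.

Lemma shear_bij (K : fieldType) (b c d : K) :
  c != 0 -> bijective (shear b c d).
Proof.
move=> c0.
exists (fun y : 'rV[K]_3 => y 0 i1 *: e1 K + ((y 0 i2 - b * y 0 i1) / c) *: e2 K
  + (y 0 i3 - d * ((y 0 i2 - b * y 0 i1) / c)) *: e3 K) => x.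
  by apply: row3P; rewrite !coordE; field.
by apply: row3P; rewrite !coordE; field.
Qed.

Lemma ad_iso_shear (K : fieldType) (b c d : K)
    (r l r' l' : 'rV[K]_3 -> 'rV[K]_3 -> 'rV[K]_3) :
  c != 0 -> splits_As33 r l -> splits_As33 r' l' ->
  (forall x y, shear b c d (r x y) = r' (shear b c d x) (shear b c d y)) ->
  ad_iso r l r' l'.
Proof.
move=> c0 hS hS' fr; exists (shear b c d : {linear _ -> _}).
split=> [||x y /=] //; first exact: shear_bij.
rewrite (splits_As33_l hS) (splits_As33_l hS') raddfB /= fr; congr (_ - _).
by apply: row3P; rewrite !(shear_coord, coordE); ring.
Qed.

(** Here g is the Gram matrix of the form h in the basis e_1 + b e_2,
c e_2. *)
Definition congruent (K : fieldType) (g h : gram K) :=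
  exists b c : K, c != 0 /\
  [/\ g11 g = g11 h + b * (g12 h + g21 h) + b ^+ 2 * g22 h,
      g12 g = c * (g12 h + b * g22 h),
      g21 g = c * (g21 h + b * g22 h)
    & g22 g = c ^+ 2 * g22 h].

Lemma ad_iso_of_congruent (K : fieldType) (g h : gram K)
    (r l r' l' : 'rV[K]_3 -> 'rV[K]_3 -> 'rV[K]_3) :
  splits_As33 r l -> splits_As33 r' l' ->
  r =2 form_prod g -> r' =2 form_prod h ->
  congruent g h -> ad_iso r l r' l'.
Proof.
move=> hS hS' rE r'E [b [c [c0 [h11 h12 h21 h22]]]].
apply: (ad_iso_shear (b := b) (c := c) (d := 0)) => // x y; rewrite rE r'E /form_prod.
rewrite h11 h12 h21 h22.
by apply: row3P; rewrite !(shear_coord, coordE); ring.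
Qed.

(** The image of e_3 = e_1 . e_1 is forced to be a ^+ 2 *: e_3, and e_2 must
stay in the span of e_2 and e_3 since e_2 . e_2 = 0; injectivity excludes that
a or c vanishes. *)
Lemma As33_automorphism (K : fieldType)
    (r l r' l' : 'rV[K]_3 -> 'rV[K]_3 -> 'rV[K]_3)
    (f : {linear 'rV[K]_3 -> 'rV[K]_3}) :
  splits_As33 r l -> splits_As33 r' l' -> injective f ->
  (forall x y, f (r x y) = r' (f x) (f y)) ->
  (forall x y, f (l x y) = l' (f x) (f y)) ->
  exists a b c d : K, [/\ a != 0, c != 0, f (e3 K) = a ^+ 2 *: e3 K,
    f (e1 K) 0 i1 = a /\ f (e1 K) 0 i2 = b & f (e2 K) = c *: e2 K + d *: e3 K].
Proof.
move=> hS hS' f_inj fr fl.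
have f0 x : f x = 0 -> x = 0 by move=> h; apply: f_inj; rewrite h raddf0.
have fM x y : f (As33 x y) = As33 (f x) (f y).
  by rewrite -hS -hS' raddfD /= fr fl.
have fe3 : f (e3 K) = (f (e1 K) 0 i1) ^+ 2 *: e3 K.
  by have := fM (e1 K) (e1 K); rewrite !As33E !coordE mulr1 scale1r expr2.
have a0 : f (e1 K) 0 i1 != 0.
  apply/eqP => a0; move: fe3; rewrite a0 expr0n scale0r => /f0/eqP.
  by rewrite (negPf (e3_neq0 K)).
have f21 : f (e2 K) 0 i1 = 0.
  have := fM (e2 K) (e2 K); rewrite !As33E !coordE mul0r scale0r raddf0.
  move=> /esym/eqP.
  by rewrite scaler_eq0 (negPf (e3_neq0 K)) orbF mulf_eq0 orbb => /eqP.
have fe2 : f (e2 K) = f (e2 K) 0 i2 *: e2 K + f (e2 K) 0 i3 *: e3 K.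
  by rewrite {1}[f _]row3_decomp f21 scale0r add0r.
exists (f (e1 K) 0 i1), (f (e1 K) 0 i2), (f (e2 K) 0 i2), (f (e2 K) 0 i3).
split=> //; apply/eqP => c0; move: fe2; rewrite c0 scale0r add0r.
set a := f (e1 K) 0 i1 in fe3 a0; set d := f (e2 K) 0 i3 => fe2.
have /f0 : f (e2 K - (d / a ^+ 2) *: e3 K) = 0.
  rewrite raddfB /= linearZ /= fe2 fe3 scalerA divfK ?subrr //.
  by rewrite expf_neq0.
move=> /(congr1 (fun v : 'rV[K]_3 => v 0 i2)) /eqP.
by rewrite !coordE mulr0 subr0 oner_eq0.
Qed.

(** Comparing e_3-components shows that a ^+ 2 times the first form is the
pull-back of the second one; dividing the coefficients b and c by a absorbs
this factor. *)
Lemma congruent_of_ad_iso (K : fieldType) (g h : gram K)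
    (r l r' l' : 'rV[K]_3 -> 'rV[K]_3 -> 'rV[K]_3) :
  splits_As33 r l -> splits_As33 r' l' ->
  r =2 form_prod g -> r' =2 form_prod h ->
  ad_iso r l r' l' -> congruent g h.
Proof.
move=> hS hS' rE r'E [f [/bij_inj f_inj fr fl]].
have [a [b [c [d [a0 c0 fe3 [f11 f12] fe2]]]]] :=
  As33_automorphism hS hS' f_inj fr fl.
have fform x y := congr1 (fun v : 'rV[K]_3 => v 0 i3) (fr x y).
exists (b / a), (c / a); split; first by rewrite mulf_neq0 ?invr_eq0.
have := (fform (e1 K) (e1 K), fform (e1 K) (e2 K),
  fform (e2 K) (e1 K), fform (e2 K) (e2 K)).
rewrite !rE !r'E /form_prod !linearZ /= fe3 fe2 !coordE f11 f12.
rewrite !(mulr0, mulr1, addr0, add0r) => -[[[E11 E12] E21] E22].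
have cancelE p q : p * a ^+ 2 = q -> p = q / a ^+ 2.
  by move=> <-; rewrite mulfK // expf_neq0.
by split; [rewrite (cancelE _ _ E11) | rewrite (cancelE _ _ E12)
  | rewrite (cancelE _ _ E21) | rewrite (cancelE _ _ E22)]; field.
Qed.

(** An isomorphism would send e_2 = e_1 r e_1 to a multiple of e_3, but it
keeps the e_2-component of e_2 nonzero. *)
Lemma square_not_iso_form (K : fieldType) (g : gram K)
    (r l r' l' : 'rV[K]_3 -> 'rV[K]_3 -> 'rV[K]_3) :
  splits_As33 r l -> splits_As33 r' l' ->
  r =2 square_prod (e2 K) -> r' =2 form_prod g -> ~ ad_iso r l r' l'.
Proof.
move=> hS hS' rE r'E [f [/bij_inj f_inj fr fl]].
have [a [b [c [d [a0 c0 fe3 _ fe2]]]]] :=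
  As33_automorphism hS hS' f_inj fr fl.
have := congr1 (fun v : 'rV[K]_3 => v 0 i2) (fr (e1 K) (e1 K)).
rewrite rE r'E /square_prod /form_prod !coordE mulr1 scale1r fe2 !coordE.
rewrite !mulr0 addr0 mulr1 => /eqP.
by rewrite (negPf c0).
Qed.

(** * The listed algebras *)

Definition gram_of (K : fieldType) (s : ad_label K) : option (gram K) :=
  match s with
  | AD18 a => Some (Gram a 0 0 0)
  | AD19 => Some (Gram 0 0 1 0)
  | AD20 a => Some (Gram a 1 (-1) 0)
  | AD21 a => Some (Gram 0 1 a 0)
  | AD22 a b => Some (Gram a 0 b 1)
  | AD23 => None
  end.

Lemma ad_r_form (K : fieldType) (s : ad_label K) (g : gram K) :
  gram_of s = Some g -> ad_r s =2 form_prod g.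
Proof.
by case: s => [a||a|a|a b|] //= [<-] x y;
  rewrite /table_prod /form_prod !big_cons big_nil /=;
  apply: row3P; rewrite !coordE; ring.
Qed.

Lemma ad_r_AD23 (K : fieldType) : ad_r AD23 =2 square_prod (e2 K).
Proof. by move=> x y; rewrite /= /table_prod big_seq1. Qed.

Lemma splits_As33_ad (K : fieldType) (s : ad_label K) :
  splits_As33 (ad_r s) (ad_l s).
Proof.
by case: s => [a||a|a|a b|] x y;
  rewrite /assoc_prod As33E /= /table_prod !big_cons !big_nil /=;
  apply: row3P; rewrite !coordE; ring.
Qed.

Lemma nil_split_ext (K : fieldType) (r r' : 'rV[K]_3 -> 'rV[K]_3 -> 'rV[K]_3) :
  r =2 r' -> nil_split r' -> nil_split r.
Proof.
move=> rE [rB e3l e3r rr rl r1]; split=> *; rewrite ?rE //.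
by split=> u a x y /=; rewrite !rE; [exact: rB.1 | exact: rB.2].
Qed.

Lemma nil_split_ad (K : fieldType) (s : ad_label K) : nil_split (ad_r s).
Proof.
case sE : (gram_of s) => [g|].
  by apply: (nil_split_ext _ (nil_split_form g)); exact: ad_r_form.
case: s sE => // _; apply: (nil_split_ext (@ad_r_AD23 K)).
by apply: nil_split_square; rewrite coordE.
Qed.

(** * Normal forms of Gram matrices *)

(** If g22 is nonzero, one scales e_2 to make it 1 and uses b to kill g12.
Otherwise b changes g11 by a multiple of g12 + g21, so g11 can be made zero
unless g12 + g21 = 0; the scaling by c normalises g12, or g21 if g12 = 0. *)
Lemma congruent_listed (K : fieldType) (g : gram K) :
  (forall x : K, exists y, y ^+ 2 = x) ->
  exists s h, [/\ listed s, gram_of s = Some h & congruent g h].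
Proof.
move=> sqrtK; case: g => [p q u v].
have [v0|vN0] := eqVneq v 0; last first.
  have [c cE] := sqrtK v.
  have c0 : c != 0 by apply: contra_neq vN0 => c0; rewrite -cE c0 expr0n.
  pose b := q / c; pose be := u / c - b.
  exists (AD22 (p - b * be - b ^+ 2) be), (Gram (p - b * be - b ^+ 2) 0 be 1).
  split=> //; exists b, c; split=> //=.
  by rewrite -cE /be /b; split; field.
have [q0|qN0] := eqVneq q 0; last first.
  have [m uE] : exists m, u = m * q by exists (u / q); rewrite divfK.
  have [m1|mN1] := eqVneq m (-1).
    exists (AD20 p), (Gram p 1 (-1) 0); split=> //; exists 0, q; split=> //=.
    by rewrite v0 uE m1; split; ring.
  exists (AD21 m), (Gram 0 1 m 0); split=> //=; first exact/eqP.
  have d0 : 1 + m != 0 by rewrite addrC addr_eq0.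
  by exists (p / (1 + m)), q; split=> //=; rewrite v0 uE; split; field.
have [u0|uN0] := eqVneq u 0.
  exists (AD18 p), (Gram p 0 0 0); split=> //; exists 0, 1.
  by rewrite oner_eq0 /= q0 u0 v0; split=> //; split; ring.
exists AD19, (Gram 0 0 1 0); split=> //; exists p, u.
by rewrite /= q0 v0; split=> //; split; ring.
Qed.

Lemma congruent_g22 (K : fieldType) (g h : gram K) :
  congruent g h -> (g22 g == 0) = (g22 h == 0).
Proof.
by move=> [x [c [c0 [_ _ _ ->]]]]; rewrite mulf_eq0 expf_eq0 /= (negPf c0).
Qed.

Lemma congruent_degenerate (K : fieldType) (g h : gram K) :
  g22 h = 0 -> congruent g h ->
  [/\ (g12 g == 0) = (g12 h == 0), (g21 g == 0) = (g21 h == 0),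
      g12 g * g21 h = g21 g * g12 h
    & g12 h + g21 h = 0 -> g11 g = g11 h].
Proof.
move=> h0 [x [c [c0 [-> -> -> _]]]]; rewrite h0 !(mulr0, addr0).
split; first by rewrite mulf_eq0 (negPf c0).
- by rewrite mulf_eq0 (negPf c0).
- by ring.
- by move=> ->; rewrite mulr0 addr0.
Qed.

(** The entry g12 = 0 rules out any b, and g22 = 1 forces c to be 1 or - 1,
the latter changing the sign of g21. *)
Lemma congruent_AD22 (K : fieldType) (a b a' b' : K) :
  congruent (Gram a 0 b 1) (Gram a' 0 b' 1) -> a = a' /\ (b' = b \/ b' = - b).
Proof.
move=> [x [c [c0 /= [h11 h12 h21 h22]]]].
have x0 : x = 0.
  move: h12; rewrite add0r mulr1 => /esym/eqP.
  by rewrite mulf_eq0 (negPf c0) => /eqP.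
move: h11 h21; rewrite x0 !(mul0r, mulr0, addr0) expr0n mul0r addr0 => -> ->.
split=> //; move/esym/eqP: h22; rewrite mulr1 sqrf_eq1.
by case/orP=> /eqP->; [left | right]; rewrite ?mul1r // mulN1r opprK.
Qed.

(** The invariants above leave only pairs of labels with the same name, and
the pair AD20, AD21: there the ratio of g12 and g21 is - 1 for AD20, which is
the value excluded for AD21. *)
Lemma congruent_separates (K : fieldType) (s t : ad_label K) (g h : gram K) :
  listed s -> listed t -> gram_of s = Some g -> gram_of t = Some h ->
  congruent g h ->
  s = t \/ exists a b : K, s = AD22 a b /\ t = AD22 a (- b).
Proof.
case: s => [a||a|a|a b|] // sL; case: t => [a'||a'|a'|a' b'|] //= tL;
  move=> [<-] [<-] gh; have := congruent_g22 gh;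
  rewrite /= ?eqxx ?oner_eq0 // => _;
  last by have [-> [->|->]] := congruent_AD22 gh; [left | right; exists a', b].
all: have := congruent_degenerate _ gh; rewrite /= ?(oppr_eq0, eqxx, oner_eq0).
all: case=> // _ _ + fix11; rewrite ?mul1r ?mulr1 => ratio.
- by left; rewrite fix11 ?addr0.
- by left.
- by left; rewrite fix11 ?subrr.
- by case: tL.
- by case: sL.
- by left; rewrite ratio.
Qed.

(** The substitution e_2 -> - e_2. *)
Lemma congruent_AD22_opp (K : fieldType) (a b : K) :
  congruent (Gram a 0 b 1) (Gram a 0 (- b) 1).
Proof.
exists 0, (-1); rewrite oppr_eq0 oner_eq0; split=> //=.
by split; ring.
Qed.

(** * The classification *)

Lemma classification (K : fieldType)
    (r l : 'rV[K]_3 -> 'rV[K]_3 -> 'rV[K]_3) :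
  (forall x : K, exists y, y ^+ 2 = x) ->
  splits_As33 r l -> anti_dendriform r l ->
  exists s : ad_label K, listed s /\ ad_iso r l (ad_r s) (ad_l s).
Proof.
move=> sqrtK hS hA.
case: (nil_splitP (nil_split_of_anti_dendriform hS hA)).
  case=> v [v1 v2] rE; exists AD23; split=> //; apply: ad_iso_sym.
  apply: (ad_iso_shear (b := 0) (c := v 0 i2) (d := v 0 i3)) => //.
    exact: splits_As33_ad.
  move=> x y; rewrite ad_r_AD23 rE /square_prod.
  by apply: row3P; rewrite !(shear_coord, coordE) ?v1; ring.
case=> g rE; have [s [h [sL sE gh]]] := congruent_listed g sqrtK.
exists s; split=> //.
apply: (ad_iso_of_congruent (g := g) (h := h)) => //; first exact: splits_As33_ad.
exact: ad_r_form.
Qed.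

Lemma ad_iso_listedP (K : fieldType) (s t : ad_label K) :
  listed s -> listed t ->
  ad_iso (ad_r s) (ad_l s) (ad_r t) (ad_l t) <->
  s = t \/ exists a b : K, s = AD22 a b /\ t = AD22 a (- b).
Proof.
move=> sL tL; have hS := @splits_As33_ad K.
split; last first.
  case=> [->|[a [b [-> ->]]]]; first exact: ad_iso_refl.
  apply: (ad_iso_of_congruent (hS _) (hS _) _ _
    (congruent_AD22_opp a b)); exact: ad_r_form.
case sE : (gram_of s) => [g|]; case tE : (gram_of t) => [h|].
- move=> /(congruent_of_ad_iso (hS _) (hS _)
    (ad_r_form sE) (ad_r_form tE)).
  exact: congruent_separates.
- case: t tE {tL} => // _ /ad_iso_sym.
  by case/(square_not_iso_form (hS _) (hS _) (@ad_r_AD23 K)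
    (ad_r_form sE)).
- case: s sE {sL} => // _.
  by case/(square_not_iso_form (hS _) (hS _) (@ad_r_AD23 K)
    (ad_r_form tE)).
- by case: s sE {sL} => //; case: t tE {tL} => // _ _; left.
Qed.

Theorem theorem4p5 (R : realType) :
  [/\ (* the listed algebras are anti-dendriform and associated to As_3^3 *)
      forall s : ad_label R[i], listed s ->
        anti_dendriform (ad_r s) (ad_l s) /\
        associated_to (ad_r s) (ad_l s) (@As33 R[i]),
      (* the list is complete *)
      forall (A : vectType R[i]) (r l : A -> A -> A),
        \dim {:A} = 3%N -> anti_dendriform r l ->
        associated_to r l (@As33 R[i]) ->
        exists s : ad_label R[i],
          listed s /\ ad_iso r l (ad_r s) (ad_l s),
      (* distinct members are non-isomorphic, except that the sign of the
         second parameter of AD22 is irrelevant *)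
      forall s t : ad_label R[i], listed s -> listed t ->
        (ad_iso (ad_r s) (ad_l s) (ad_r t) (ad_l t) <->
         s = t \/ exists a b : R[i], s = AD22 a b /\ t = AD22 a (- b))
    & ad_iso (ad_r (AD21 (-1 : R[i]))) (ad_l (AD21 (-1 : R[i])))
             (ad_r (AD20 (0 : R[i]))) (ad_l (AD20 (0 : R[i])))].
Proof.
have hS := @splits_As33_ad R[i]; split.
- move=> s _; split; last exact: alg_iso_refl (hS s).
  exact: anti_dendriform_of_nil_split (hS s) (nil_split_ad s).
- move=> A r l _ hA hAs.
  have [r' [l' [hA' hS' iso]]] := transport_to_As33 hA hAs.
  have [|s [sL siso]] := classification _ hS' hA'.
    by move=> x; exists (sqrtc x); rewrite sqr_sqrtc.
  by exists s; split=> //; exact: ad_iso_trans iso siso.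
- exact: ad_iso_listedP.
- have rE : ad_r (AD21 (-1 : R[i])) =2 ad_r (AD20 0).
    by move=> x y; rewrite !(ad_r_form (g := Gram 0 1 (-1) 0)).
  apply: ad_iso_refl => // x y.
  by rewrite !(splits_As33_l (hS _)) rE.
Qed.
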